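(* We have $\theta(1)=1$ and $\theta(2)=2$. Moreover, the inequality $\theta(n) \geqslant 2^{2^{n-2}}$ holds for every integer $n \geqslant 3$.
   Context: For a positive integer $n$, let $E_n=\{x_i \cdot x_j=x_k,\ x_i+1=x_k:\ i,j,k \in \{1,\ldots,n\}\}$, a set of equations in the variables $x_1,\ldots,x_n$. Let $\theta(n)$ denote the smallest positive integer $b$ such that for each system $S \subseteq E_n$ which has a solution in positive integers $x_1,\ldots,x_n$ and which has only finitely many solutions in positive integers $x_1,\ldots,x_n$, there exists a solution of $S$ in $([1,b] \cap \mathbb{N})^n$. *)

(* Defs.v *)
From HB Require Import structures.
From mathcomp Require Import all_boot.
From mathcomp Require Import boolp classical_sets cardinality.

Set Implicit Arguments.
Unset Strict Implicit.
Unset Printing Implicit Defensive.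

(* The elements of E_n; the variables x_1, ..., x_n are indexed by 'I_n. *)
Inductive equation (n : nat) : Type :=
| EqMul of 'I_n & 'I_n & 'I_n  (* EqMul i j k is x_i * x_j = x_k *)
| EqSucc of 'I_n & 'I_n.       (* EqSucc i k is x_i + 1 = x_k *)

Section EquationFinite.
Variable n : nat.

Definition equation_encode (e : equation n) :
    ('I_n * 'I_n * 'I_n) + ('I_n * 'I_n) :=
  match e with
  | EqMul i j k => inl (i, j, k)
  | EqSucc i k => inr (i, k)
  end.

Definition equation_decode
    (u : ('I_n * 'I_n * 'I_n) + ('I_n * 'I_n)) : equation n :=
  match u with
  | inl (i, j, k) => EqMul i j k
  | inr (i, k) => EqSucc i k
  end.

Lemma equation_encodeK : cancel equation_encode equation_decode.
Proof. by case. Qed.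

HB.instance Definition _ :=
  Finite.copy (equation n) (can_type equation_encodeK).

End EquationFinite.

Definition holds (n : nat) (x : {ffun 'I_n -> nat}) (e : equation n) : Prop :=
  match e with
  | EqMul i j k => x i * x j = x k
  | EqSucc i k => x i + 1 = x k
  end.

Definition solution (n : nat) (S : {set equation n}) (x : {ffun 'I_n -> nat}) :
    Prop :=
  (forall i, 0 < x i) /\ (forall e, e \in S -> holds x e).

Definition solutions (n : nat) (S : {set equation n}) :
    set {ffun 'I_n -> nat} :=
  fun x => solution S x.

Definition theta_bound (n b : nat) : Prop :=
  forall S : {set equation n},
    (exists x, solution S x) -> finite_set (solutions S) ->
    exists x, solution S x /\ (forall i, 1 <= x i <= b).

Lemma theta_bound_exists (n : nat) :
  exists b, `[< 0 < b /\ theta_bound n b >].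
Proof.
have /choice[f fP] : forall S : {set equation n}, exists x : {ffun 'I_n -> nat},
    (exists x, solution S x) -> solution S x.
  move=> S; case: (pselect (exists x, solution S x)) => [[x xS]|noS].
    by exists x.
  by exists [ffun=> 0].
exists (\max_(S : {set equation n}) \max_(i < n) f S i).+1.
apply/asboolP; split=> // S exS _; exists (f S).
have fS := fP S exS; split=> // i; rewrite fS.1 /= ltnW // ltnS.
apply: leq_trans (leq_bigmax S); exact: leq_bigmax.
Qed.

Definition theta (n : nat) : nat := ex_minn (theta_bound_exists n).

(* Main.v *)
Require Import Defs.
From mathcomp Require Import all_boot.
From mathcomp Require Import boolp classical_sets cardinality.
From mathcomp Require Import zify.

(** The system [x_1 * x_1 = x_1], [x_1 + 1 = x_2], [x_i * x_i = x_(i+1)] for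
    [i >= 2] forces the values [1, 2, 4, 16, ...], the last one being
    [2 ^ (2 ^ (n - 2))]. Conversely, for [n <= 2], a solvable system without
    successor equations is solved by the constant [1], while a successor
    equation [x_a + 1 = x_b] is compatible with a multiplication only if
    [x_a = 1] and [x_b = 2]. *)

Set Implicit Arguments.
Unset Strict Implicit.
Unset Printing Implicit Defensive.

Lemma theta_gt0 (n : nat) : 0 < theta n.
Proof. by rewrite /theta; case: ex_minnP => b /asboolP[]. Qed.

Lemma theta_boundP (n : nat) : theta_bound n (theta n).
Proof. by rewrite /theta; case: ex_minnP => b /asboolP[]. Qed.

Lemma theta_le (n b : nat) : 0 < b -> theta_bound n b -> theta n <= b.
Proof.
rewrite /theta; case: ex_minnP => m _ minm b_gt0 bP.
by apply: minm; apply/asboolP.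
Qed.

(** A singleton solution set is finite, so the solution in [[1, theta n]] promised by the bound can
    only be [x]. *)
Lemma theta_ge_unique (n : nat) (S : {set equation n}) (x : {ffun 'I_n -> nat})
    (i : 'I_n) :
  solution S x -> (forall y, solution S y -> y = x) -> x i <= theta n.
Proof.
move=> xS uniqx.
have finS : finite_set (solutions S).
  by apply: sub_finite_set (finite_set1 x) => y /uniqx.
have [y [/uniqx -> xle]] := theta_boundP (ex_intro _ x xS) finS.
by case/andP: (xle i).
Qed.

(* Indices start at [0], so variable [i] of the system is [x_(i+1)]. *)
Definition squaring_system (n : nat) : {set equation n} :=
  [set e | match e with
           | EqMul i j k => (i == j) && (k == i + (0 < i) :> nat)
           | EqSucc i k => (i == 0 :> nat) && (k == 1 :> nat)
           end].

Definition tower (k : nat) : nat := if k is k'.+1 then 2 ^ (2 ^ k') else 1.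

Lemma tower_gt0 (k : nat) : 0 < tower k.
Proof. by case: k => //= k; rewrite expn_gt0. Qed.

(** The coerced boolean is the index shift of [squaring_system]: 1 squares to itself, every later
    value to the next one. *)
Lemma tower_sqr (k : nat) : tower k * tower k = tower (k + (0 < k)).
Proof.
by case: k => [|k] //=; rewrite addn1 -expnD addnn -mul2n -expnS.
Qed.

Lemma squaring_system_tower (n : nat) :
  solution (squaring_system n) [ffun i : 'I_n => tower i].
Proof.
split=> [i|e]; first by rewrite ffunE tower_gt0.
rewrite inE; case: e => [i j k|i k] /andP[] /=; rewrite !ffunE.
  by move=> /eqP <- /eqP ->; rewrite tower_sqr.
by move=> /eqP -> /eqP ->.
Qed.

Lemma squaring_system_unique (n : nat) (y : {ffun 'I_n -> nat}) :
  solution (squaring_system n) y -> y = [ffun i : 'I_n => tower i].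
Proof.
move=> [y_gt0 yS]; apply/ffunP => -[k ltkn]; rewrite ffunE /=.
elim: k ltkn => [|k IHk] ltkn /=.
  set i := Ordinal ltkn.
  have /yS/= : EqMul i i i \in squaring_system n by rewrite inE !eqxx.
  by rewrite -[RHS]muln1 => /eqP; rewrite eqn_pmul2l ?y_gt0 // => /eqP.
pose i := Ordinal (ltnW ltkn); set j := Ordinal ltkn.
(* Index 1 is reached from index 0 by the successor equation, all later indices by squaring. *)
have := IHk (ltnW ltkn); rewrite -/i; case: k {IHk} => [|k] in ltkn i j *.
  move=> /= yi1.
  have /yS/= : EqSucc i j \in squaring_system n by rewrite inE.
  by rewrite yi1 => <-.
move=> yi.
have /yS/= : EqMul i i j \in squaring_system n by rewrite inE eqxx /= addn1.
by rewrite yi tower_sqr addn1 => <-.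
Qed.

Lemma theta_ge_tower (n : nat) : 2 <= n -> 2 ^ (2 ^ (n - 2)) <= theta n.
Proof.
case: n => [|[|n]] // _; rewrite subn2 /=.
(* The last variable has index [n.+1] and takes the largest value, [2 ^ (2 ^ n)]. *)
have := theta_ge_unique ord_max (squaring_system_tower n.+2)
          (@squaring_system_unique n.+2).
by rewrite ffunE.
Qed.

Lemma solution_ones (n : nat) (S : {set equation n}) :
  (forall i k, EqSucc i k \notin S) -> solution S [ffun=> 1].
Proof.
move=> noS; split=> [i|[i j k|i k] eS] /=; rewrite ?ffunE //.
by rewrite (negPf (noS i k)) in eS.
Qed.

Lemma theta_bound1 : theta_bound 1 1.
Proof.
move=> S [x [_ xS]] _; exists [ffun=> 1]; split; last by move=> i; rewrite ffunE.
(* With a single variable, a successor equation would read [x + 1 = x]. *)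
apply: solution_ones => i k; apply/negP => /xS /= /eqP.
by rewrite !ord1 addn1 (gtn_eqF (ltnSn _)).
Qed.

Lemma ord2_cases (a b i : 'I_2) : a != b -> i = a \/ i = b.
Proof.
case: a => -[|[|//]] ?; case: b => -[|[|//]] ?; case: i => -[|[|//]] ? //= _;
  by [left; apply: val_inj | right; apply: val_inj].
Qed.

Lemma theta_bound2 : theta_bound 2 2.
Proof.
move=> S [x [x_gt0 xS]] _.
have [[a [b abS]]|noS] := pselect (exists a b, EqSucc a b \in S); last first.
  exists [ffun=> 1]; split; last by move=> i; rewrite ffunE.
  by apply: solution_ones => i k; apply/negP => ikS; apply: noS; exists i, k.
have /= xb := xS _ abS.
have neq_ab : a != b.
  by apply: contra_eq_neq xb => ->; rewrite addn1 (gtn_eqF (ltnSn _)).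
have ab_cases i := ord2_cases i neq_ab.
have [xa1|xa_neq1] := eqVneq (x a) 1.
  exists x; split=> [|i]; first by [].
  by case: (ab_cases i) => ->; rewrite -?xb xa1.
have xa_gt1 : 1 < x a by rewrite ltn_neqAle eq_sym xa_neq1 x_gt0.
(* The values are [m] and [m + 1] with [m >= 2], so every product is at least [2 * m], which exceeds
   [m + 1]. *)
have noMul i j k : EqMul i j k \notin S.
  apply/negP => /xS /=.
  by case: (ab_cases i) => ->; case: (ab_cases j) => ->;
    case: (ab_cases k) => ->; rewrite -?xb; nia.
exists [ffun i => if i == a then 1 else 2]; split; last first.
  by move=> i; rewrite ffunE; case: eqP.
split=> [i|[i j k|i k] eS] /=; first by rewrite ffunE; case: eqP.
  by rewrite (negPf (noMul i j k)) in eS.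
(* The solution [x] rules out every successor equation other than [EqSucc a b], which the values 1
   and 2 satisfy. *)
have /= := xS _ eS; rewrite !ffunE.
case: (ab_cases i) => ->; case: (ab_cases k) => ->;
  by rewrite ?eqxx ?(eq_sym b) ?(negPf neq_ab) -?xb //; lia.
Qed.

Theorem theorem1 :
  theta 1 = 1 /\ theta 2 = 2 /\
  (forall n : nat, 3 <= n -> 2 ^ (2 ^ (n - 2)) <= theta n).
Proof.
split; first by apply/eqP; rewrite eqn_leq theta_gt0 (theta_le _ theta_bound1).
split; last by move=> n /ltnW; exact: theta_ge_tower.
by apply/eqP; rewrite eqn_leq (theta_le _ theta_bound2) //= (@theta_ge_tower 2).
Qed.
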